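(* Let $L$ satisfy the standing assumptions on inexact smoothness functions, and let $c_L$ be its self-smoothness constant. Let $\mathcal{H}=\{(x_i,f_i,g_i)\}_{i\in\mathcal{I}}$ be a set of observations with $x_i,g_i\in\mathbb{R}^d$, $f_i\in\mathbb{R}$. If $\mathcal{H}$ is $L(\cdot)$-interpolable, then for each $i,j\in\mathcal{I}$, $$f_i-f_j-\langle g_j,x_i-x_j\rangle-\frac{1}{2L(\delta)}\|g_i-g_j\|^2+\delta\ge 0\qquad\forall\,\delta\ge 0.$$ Conversely, if $f_i-f_j-\langle g_j,x_i-x_j\rangle-\frac{1}{2L(\delta)}\|g_i-g_j\|^2+\delta\ge 0$ holds for all $\delta\ge 0$ and all $i,j\in\mathcal{I}$, then $\mathcal{H}$ is $\tilde L(\cdot)$-interpolable, where $\tilde L(\delta)=c_L\,L(\delta/c_L)$.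
   Context: Norms are Euclidean, $1/\infty=0$. Standing assumptions on $L:[0,\infty)\to(0,\infty]$: $L$ is finite for all $\delta>0$, convex, lower semicontinuous, nonincreasing, and $-1/L(\cdot)$ is convex. A closed, convex, proper function $f:\mathbb{R}^d\to(-\infty,\infty]$ is called $L(\cdot)$-inexactly smooth if for all $x,y\in\mathbb{R}^d$, all $g_x\in\partial f(x)$ (convex subdifferential) and all $\delta\ge 0$, $$f(y)\le f(x)+\langle g_x,y-x\rangle+\frac{L(\delta)}{2}\|y-x\|^2+\delta$$ (nothing is imposed when $L(\delta)=\infty$). Observations $\mathcal{H}=\{(x_i,f_i,g_i)\}_{i\in\mathcal{I}}$ are $L(\cdot)$-interpolable if there is a convex, $L(\cdot)$-inexactly smooth function $f$ on $\mathbb{R}^d$ with $f(x_i)=f_i$ and $g_i\in\partial f(x_i)$ for all $i\in\mathcal{I}$. Define $\theta_L:\mathbb{R}\to\mathbb{R}$ by $\theta_L(s)=\inf_{\delta\ge 0}\{\frac{L(\delta)}{2}s^2+\delta\}$. The self-smoothness constant is $$c_L=\inf\{c>0:\theta_L\text{ is }c\,L(\cdot/c)\text{-inexactly smooth}\}.$$ *)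

(* Defs.v *)
From HB Require Import structures.
From mathcomp Require Import all_boot all_order all_algebra.
From mathcomp Require Import all_classical all_reals all_analysis.

Set Implicit Arguments.
Unset Strict Implicit.
Unset Printing Implicit Defensive.

Import Order.TTheory GRing.Theory Num.Theory.
Import numFieldNormedType.Exports.

Local Open Scope classical_set_scope.
Local Open Scope ring_scope.

(* The library's [`|u|] on ['rV[R]_d] is the sup norm, hence [enorm]; both
   induce the topology used by [lower_semicontinuous] below. *)
Definition dot (R : realType) (d : nat) (u v : 'rV[R]_d) : R :=
  (u *m v^T) 0 0.

Definition enorm (R : realType) (d : nat) (u : 'rV[R]_d) : R :=
  Num.sqrt (dot u u).

(* Only used for functions that do not take the value -oo on [D], so the sum is
   never of the form +oo - oo; at t = 0 and t = 1 the convention 0 * +oo = 0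
   makes the inequality trivial. *)
Definition econvex_on (R : realType) (E : lmodType R) (D : set E)
    (f : E -> \bar R) : Prop :=
  forall (x y : E) (t : R), D x -> D y -> 0 <= t <= 1 ->
    (f (t *: x + (1 - t) *: y)%R <= t%:E * f x + (1 - t)%:E * f y)%E.

(* L : [0, +oo) -> (0, +oo] is represented by a function on R whose values at
   negative arguments are never used: the points of [subspace `[0, +oo[] outside
   [0, +oo) are isolated, so semicontinuity is trivial there.
   In \bar R, +oo^-1 = 0. *)
Record inexact_smoothness_fun (R : realType) (L : R -> \bar R) : Prop := {
  isf_gt0 : forall delta : R, 0 <= delta -> (0 < L delta)%E ;
  isf_fin : forall delta : R, 0 < delta -> (L delta < +oo)%E ;
  isf_convex : @econvex_on R R^o `[0, +oo[ L ;
  isf_lsc : lower_semicontinuous (L : subspace `[0, +oo[ -> \bar R) ;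
  isf_noninc : forall delta delta' : R,
    0 <= delta -> delta <= delta' -> (L delta' <= L delta)%E ;
  isf_oppV_convex :
    @econvex_on R R^o `[0, +oo[ (fun delta => - (L delta)^-1)%E }.

Definition proper_fun (R : realType) (d : nat) (f : 'rV[R]_d -> \bar R) : Prop :=
  (forall x, (-oo < f x)%E) /\ (exists x, (f x < +oo)%E).

Definition subdifferential (R : realType) (d : nat) (f : 'rV[R]_d -> \bar R)
    (x : 'rV[R]_d) : set 'rV[R]_d :=
  [set g | forall y, (f x + (dot g (y - x)%R)%:E <= f y)%E].

(* A convex function is closed when it is lower semicontinuous. *)
Definition inexactly_smooth (R : realType) (L : R -> \bar R) (d : nat)
    (f : 'rV[R]_d -> \bar R) : Prop :=
  [/\ lower_semicontinuous f, econvex_on setT f, proper_fun f &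
    forall (x y g : 'rV[R]_d) (delta : R),
      subdifferential f x g -> 0 <= delta -> (L delta < +oo)%E ->
      (f y <= f x + (dot g (y - x)%R)%:E
              + L delta / 2%:E * (enorm (y - x)%R ^+ 2)%:E + delta%:E)%E].

Definition interpolable (R : realType) (L : R -> \bar R) (d : nat) (I : Type)
    (x : I -> 'rV[R]_d) (f : I -> R) (g : I -> 'rV[R]_d) : Prop :=
  exists F : 'rV[R]_d -> \bar R,
    inexactly_smooth L F /\
    forall i, F (x i) = (f i)%:E /\ subdifferential F (x i) (g i).

Definition interpolation_ineq (R : realType) (L : R -> \bar R) (d : nat)
    (I : Type) (x : I -> 'rV[R]_d) (f : I -> R) (g : I -> 'rV[R]_d) : Prop :=
  forall (i j : I) (delta : R), 0 <= delta ->
    (0 <= (f i)%:E - (f j)%:E - (dot (g j) (x i - x j)%R)%:E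
          - (2%:E * L delta)^-1 * (enorm (g i - g j)%R ^+ 2)%:E + delta%:E)%E.

(* Finite for every [inexact_smoothness_fun]: bounded below by 0, and L is finite
   at positive arguments. *)
Definition theta (R : realType) (L : R -> \bar R) (s : R) : \bar R :=
  ereal_inf [set (L delta / 2%:E * (s ^+ 2)%:E + delta%:E)%E
            | delta in `[0, +oo[].

Definition rescale (R : realType) (c : R) (L : R -> \bar R) : R -> \bar R :=
  fun delta => (c%:E * L (delta / c)%R)%E.

(* R is identified with 'rV[R]_1.  For an [inexact_smoothness_fun] the set is
   nonempty (it contains 2) and bounded below by 1, so that the real [inf] is
   the actual infimum and is positive. *)
Definition self_smoothness (R : realType) (L : R -> \bar R) : R :=
  inf [set c : R | 0 < c /\
        inexactly_smooth (rescale c L)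
          (fun s : 'rV[R]_1 => theta L (s 0 0))].

(* Main.v *)
(* theta is both an infimum of even parabolas (so it is concave as a function of
   s^2) and convex; hence it is differentiable away from 0, and a parabola
   touching it at s yields its subgradient there.  This reduces the smoothness of
   theta(|.|) on R^d to the one-dimensional inequality defining c_L.

   The interpolant is the largest convex minorant F of the functions
     p_j(y) = f_j + <g_j, y - x_j> + theta(|y - x_j|);
   the interpolation inequalities say exactly that each affine function
   f_i + <g_i, . - x_i> is below every p_j, so that F interpolates.  Its smoothness
   is obtained without any representation by convex combinations: the p_j satisfy
     t p(y + r) + p(y - t r) <= (1 + t) p(y) + t c (1 + t)^2 theta(|r|),
   an inequality that bounds p from below by a convex function of y as soon as p
   is replaced by F on the left, hence passes to F by maximality; letting t -> 0
   recovers smoothness along every subgradient of F. *)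
Require Import Defs.
From mathcomp Require Import all_boot all_order all_algebra.
From mathcomp Require Import all_classical all_reals all_analysis.
From mathcomp Require Import ring lra.

Set Implicit Arguments.
Unset Strict Implicit.
Unset Printing Implicit Defensive.

Import Order.TTheory GRing.Theory Num.Theory.
Import numFieldNormedType.Exports.

Local Open Scope classical_set_scope.
Local Open Scope ring_scope.

(** * Properties of theta *)

Lemma isf_fineE (R : realType) (L : R -> \bar R) (hL : inexact_smoothness_fun L)
    (e : R) : 0 <= e -> (L e < +oo)%E -> L e = (fine (L e))%:E /\ 0 < fine (L e).
Proof.
move=> e0 hfin; have := isf_gt0 hL e0; move: hfin.
by case: (L e) => [r| |] //= _; rewrite lte_fin.
Qed.

Lemma isf_posE (R : realType) (L : R -> \bar R) (hL : inexact_smoothness_fun L)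
    (e : R) : 0 < e -> L e = (fine (L e))%:E /\ 0 < fine (L e).
Proof. by move=> e0; apply: (isf_fineE hL (ltW e0)); exact: isf_fin. Qed.

Lemma isf_inv_concave (R : realType) (L : R -> \bar R)
    (hL : inexact_smoothness_fun L) (a b t : R) :
  0 < a -> 0 < b -> 0 <= t <= 1 ->
  t / fine (L a) + (1 - t) / fine (L b) <= (fine (L (t * a + (1 - t) * b)))^-1.
Proof.
move=> a0 b0 /andP[t0 t1].
have c0 : 0 < t * a + (1 - t) * b.
  have [->|tn0] := eqVneq t 0; first by rewrite mul0r add0r subr0 mul1r.
  have t'0 : 0 <= 1 - t by rewrite subr_ge0.
  have tp : 0 < t by rewrite lt0r tn0.
  by apply: ltr_pwDl; [exact: mulr_gt0 | exact: mulr_ge0 t'0 (ltW b0)].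
have := isf_oppV_convex hL (x := a) (y := b) (t := t).
rewrite /= !in_itv /= !andbT => /(_ (ltW a0) (ltW b0)).
rewrite t0 t1 => /(_ isT).
rewrite -[t *: (a : R^o)]/(t * a) -[(1 - t) *: (b : R^o)]/((1 - t) * b).
have [-> la] := isf_posE hL a0; have [-> lb] := isf_posE hL b0.
have [-> lc] := isf_posE hL c0.
rewrite !inver !gt_eqF //= -!EFinM -EFinD lee_fin.
by rewrite !mulrN -opprD lerN2.
Qed.

Definition thetaR (R : realType) (L : R -> \bar R) (s : R) : R := fine (theta L s).

(** Positive [e] suffice: if [L 0] is finite, [L e <= L 0] and [e] tends to 0; if [L 0] is infinite,
    its term is [+oo] unless [s = 0], where the convention for [+oo * 0] leaves 0. *)
Lemma theta_lb (R : realType) (L : R -> \bar R) (hL : inexact_smoothness_fun L)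
    (s b : R) : (forall e, 0 < e -> b <= fine (L e) / 2 * s ^+ 2 + e) ->
  (b%:E <= theta L s)%E.
Proof.
move=> hb; apply: le_ereal_inf_tmp => y [e].
rewrite /= in_itv /= andbT => e0 <- {y}.
move: e0; rewrite le_eqVlt => /orP[/eqP <- {e}|e0]; last first.
  have [-> l0] := isf_posE hL e0.
  by rewrite inver pnatr_eq0 /= -!EFinM -EFinD lee_fin hb.
have := isf_gt0 hL (lexx 0); case hL0 : (L 0) => [r| |] // r0.
  rewrite inver pnatr_eq0 /= -!EFinM -EFinD lee_fin addr0.
  apply/ler_addgt0Pr => e e0; apply: le_trans (hb _ e0) _.
  rewrite lerD2r ler_wpM2r ?sqr_ge0 // ler_pM2r ?invr_gt0 //.
  have := isf_noninc hL (lexx 0) (ltW e0).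
  by have [-> _] := isf_posE hL e0; rewrite hL0 lee_fin.
rewrite inver pnatr_eq0 /= gt0_mulye ?lte_fin ?invr_gt0 //.
have [s0|s0] := eqVneq s 0.
  rewrite s0 expr0n /= mule0 adde0 lee_fin; apply/ler_addgt0Pr => e e0.
  by have := hb _ e0; rewrite s0 expr0n mulr0.
by rewrite gt0_mulye ?lte_fin ?exprn_even_gt0 // addye // leey.
Qed.

Lemma thetaE (R : realType) (L : R -> \bar R) (hL : inexact_smoothness_fun L)
    (s : R) : theta L s = (thetaR L s)%:E.
Proof.
have h0 : (0 <= theta L s)%E.
  apply: (theta_lb hL) => e e0.
  have [_ /ltW l0] := isf_posE hL e0.
  by rewrite addr_ge0 ?(ltW e0) // mulr_ge0 ?sqr_ge0 ?divr_ge0.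
rewrite /thetaR fineK // ge0_fin_numE //.
have : (theta L s <= L 1%R / 2%:E * (s ^+ 2)%:E + (1%R)%:E)%E.
  by apply: ereal_inf_lbound; exists 1 => //=; rewrite in_itv /= ler01.
have [-> _] := isf_posE hL (@ltr01 R).
move/le_lt_trans; apply.
by rewrite inver pnatr_eq0 /= -!EFinM -EFinD ltry.
Qed.

Lemma thetaR_le (R : realType) (L : R -> \bar R) (hL : inexact_smoothness_fun L)
    (s e : R) : 0 <= e -> (L e < +oo)%E -> thetaR L s <= fine (L e) / 2 * s ^+ 2 + e.
Proof.
move=> e0 efin.
have : (theta L s <= L e / 2%:E * (s ^+ 2)%:E + e%:E)%E.
  by apply: ereal_inf_lbound; exists e => //=; rewrite in_itv /= e0.
have [-> _] := isf_fineE hL e0 efin.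
by rewrite (thetaE hL) inver pnatr_eq0 /= -!EFinM -EFinD lee_fin.
Qed.

Lemma thetaR_ge (R : realType) (L : R -> \bar R) (hL : inexact_smoothness_fun L)
    (s b : R) : (forall e, 0 < e -> b <= fine (L e) / 2 * s ^+ 2 + e) ->
  b <= thetaR L s.
Proof. by move=> /(theta_lb hL); rewrite (thetaE hL) lee_fin. Qed.

Lemma thetaRN (R : realType) (L : R -> \bar R) (s : R) : thetaR L (- s) = thetaR L s.
Proof. by rewrite /thetaR /theta sqrrN. Qed.

Lemma thetaR_norm (R : realType) (L : R -> \bar R) (s : R) : thetaR L `|s| = thetaR L s.
Proof. by case: (ger0P s) => // _; rewrite thetaRN. Qed.

Lemma thetaR_ge0 (R : realType) (L : R -> \bar R) (hL : inexact_smoothness_fun L)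
    (s : R) : 0 <= thetaR L s.
Proof.
apply: (thetaR_ge hL) => e e0; have [_ /ltW l0] := isf_posE hL e0.
by rewrite addr_ge0 ?(ltW e0) // mulr_ge0 ?sqr_ge0 ?divr_ge0.
Qed.

Lemma thetaR0 (R : realType) (L : R -> \bar R) (hL : inexact_smoothness_fun L) :
  thetaR L 0 = 0.
Proof.
apply/le_anti; rewrite thetaR_ge0 // andbT; apply/ler_addgt0Pr => e e0.
have := thetaR_le hL 0 (ltW e0) (isf_fin hL e0).
by rewrite expr0n mulr0 !add0r.
Qed.

Lemma thetaR_gt0 (R : realType) (L : R -> \bar R) (hL : inexact_smoothness_fun L)
    (s : R) : s != 0 -> 0 < thetaR L s.
Proof.
move=> s0; have [L1 l1] := isf_posE hL (@ltr01 R).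
have q0 : 0 < fine (L 1) / 2 * s ^+ 2.
  by rewrite mulr_gt0 ?divr_gt0 // exprn_even_gt0.
(* A parabola is at least its offset [e] when [e >= 1]; for [e < 1] its curvature is at least
   [L 1]. *)
apply: (@lt_le_trans _ _ (Num.min 1 (fine (L 1) / 2 * s ^+ 2))).
  by rewrite lt_min ltr01.
apply: (thetaR_ge hL) => e e0; rewrite ge_min; have [Le le0] := isf_posE hL e0.
have [e1|e1] := leP 1 e.
  by rewrite (le_trans e1) // lerDr mulr_ge0 ?sqr_ge0 // divr_ge0 // ltW.
apply/orP; right; apply: ler_wpDr; first exact: ltW.
rewrite ler_wpM2r ?sqr_ge0 // ler_pM2r ?invr_gt0 //.
by have := isf_noninc hL (ltW e0) (ltW e1); rewrite L1 Le lee_fin.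
Qed.

Lemma thetaR_homo (R : realType) (L : R -> \bar R) (hL : inexact_smoothness_fun L)
    (s t : R) : s ^+ 2 <= t ^+ 2 -> thetaR L s <= thetaR L t.
Proof.
move=> st; apply: (thetaR_ge hL) => e e0; have [_ l0] := isf_posE hL e0.
apply: le_trans (thetaR_le hL s (ltW e0) (isf_fin hL e0)) _.
by rewrite lerD2r ler_wpM2l // divr_ge0 // ltW.
Qed.

(* The parabolas in the infimum have nonnegative value at 0, so
   [theta L s / s^2] is nonincreasing in [|s|]. *)
Lemma thetaR_quad_decr (R : realType) (L : R -> \bar R)
    (hL : inexact_smoothness_fun L) (r s : R) :
  r ^+ 2 <= s ^+ 2 -> r ^+ 2 * thetaR L s <= s ^+ 2 * thetaR L r.
Proof.
move=> rs; have [s0|s0] := eqVneq s 0.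
  by rewrite s0 (thetaR0 hL) mulr0 expr0n mul0r.
have s2 : 0 < s ^+ 2 by rewrite exprn_even_gt0.
rewrite mulrC -ler_pdivrMl //; apply: (thetaR_ge hL) => e e0.
rewrite ler_pdivrMl // mulrC.
have [_ l0] := isf_posE hL e0.
apply: le_trans (ler_wpM2l (sqr_ge0 r) (thetaR_le hL s (ltW e0) (isf_fin hL e0))) _.
have := ler_wpM2r (ltW e0) rs; lra.
Qed.

Lemma thetaR_convex (R : realType) (L : R -> \bar R) (hL : inexact_smoothness_fun L)
    (s1 s2 t : R) : 0 <= t <= 1 ->
  thetaR L (t * s1 + (1 - t) * s2) <= t * thetaR L s1 + (1 - t) * thetaR L s2.
Proof.
move=> /[dup] t01 /andP[t0 t1].
have [->|tn0] := eqVneq t 0; first by rewrite subr0 !mul0r !mul1r !add0r.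
have [->|tn1] := eqVneq t 1; first by rewrite subrr !mul0r !mul1r !addr0.
have tp : 0 < t by rewrite lt0r tn0.
have t'p : 0 < 1 - t by rewrite subr_gt0 lt_neqAle tn1.
(* Isolating the two values of [thetaR] in turn replaces each by an arbitrary parabola, with offsets
   [a] and [b]; their convex combination [e] is then tried on the left. *)
rewrite -lerBlDr -ler_pdivrMl //; apply: (thetaR_ge hL) => a a0.
rewrite ler_pdivrMl // lerBlDr [leRHS]addrC -lerBlDr -ler_pdivrMl //.
apply: (thetaR_ge hL) => b b0; rewrite ler_pdivrMl // lerBlDr.
set e := t * a + (1 - t) * b.
have e0 : 0 < e by rewrite addr_gt0 ?mulr_gt0.
apply: le_trans (thetaR_le hL _ (ltW e0) (isf_fin hL e0)) _.
have := isf_inv_concave hL a0 b0 t01; rewrite -/e.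
have [_] := isf_posE hL a0; have [_] := isf_posE hL b0.
have [_] := isf_posE hL e0.
move: (fine (L e)) (fine (L a)) (fine (L b)) => l la lb l0 lb0 la0 hl.
rewrite /e.
suff : l * (t * s1 + (1 - t) * s2) ^+ 2 <=
       t * la * s1 ^+ 2 + (1 - t) * lb * s2 ^+ 2 by lra.
rewrite -ler_pdivlMl //.
have hQ : 0 <= t * la * s1 ^+ 2 + (1 - t) * lb * s2 ^+ 2.
  by rewrite addr_ge0 // mulr_ge0 ?sqr_ge0 // mulr_ge0 // ltW.
apply: le_trans (ler_wpM2r hQ hl).
rewrite -subr_ge0.
(* The defect in a weighted Cauchy-Schwarz inequality is a multiple of a square. *)
have -> : (t / la + (1 - t) / lb) *
    (t * la * s1 ^+ 2 + (1 - t) * lb * s2 ^+ 2)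
    - (t * s1 + (1 - t) * s2) ^+ 2 =
    t * (1 - t) * (la * s1 - lb * s2) ^+ 2 / (la * lb).
  by field; rewrite !gt_eqF.
rewrite divr_ge0 //; last by rewrite mulr_ge0 // ltW.
by rewrite mulr_ge0 ?sqr_ge0 // mulr_ge0 // ltW.
Qed.

(* Each parabola is affine in [s ^+ 2], hence their infimum is concave in it. *)
Lemma thetaR_concave_sq (R : realType) (L : R -> \bar R)
    (hL : inexact_smoothness_fun L) (a b s t : R) : 0 <= t <= 1 ->
  s ^+ 2 = t * a ^+ 2 + (1 - t) * b ^+ 2 ->
  t * thetaR L a + (1 - t) * thetaR L b <= thetaR L s.
Proof.
move=> /andP[t0 t1] hs; apply: (thetaR_ge hL) => e e0.
have ha := thetaR_le hL a (ltW e0) (isf_fin hL e0).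
have hb := thetaR_le hL b (ltW e0) (isf_fin hL e0).
rewrite hs; have t'0 : 0 <= 1 - t by rewrite subr_ge0.
have := ler_wpM2l t0 ha; have := ler_wpM2l t'0 hb; lra.
Qed.

(** * Touching parabolas and one-dimensional self-smoothness *)

Lemma le_linear_perturb (R : realType) (x y C : R) : 0 <= C ->
  (forall t, 0 < t -> t <= 1 -> x <= y + t * C) -> x <= y.
Proof.
move=> C0 h; apply/ler_addgt0Pr => e e0.
have C1 : 0 < C + 1 by rewrite ltr_wpDl.
have t0 : 0 < Num.min 1 (e / (C + 1)) by rewrite lt_min ltr01 divr_gt0.
have t1 : Num.min 1 (e / (C + 1)) <= 1 by rewrite ge_min lexx.
apply: le_trans (h _ t0 t1) _; rewrite lerD2l.
apply: (@le_trans _ _ (e / (C + 1) * C)).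
  by rewrite ler_wpM2r // ge_min lexx orbT.
by rewrite mulrAC ler_pdivrMr // ler_wpM2l ?(ltW e0) // lerDl.
Qed.

(** In the variable [s ^+ 2], [a / 2] is a supergradient of the concave function that [thetaR]
    becomes; [a] is the curvature of the parabola. *)
Definition touches (R : realType) (L : R -> \bar R) (s a : R) : Prop :=
  forall t, thetaR L t <= thetaR L s + a / 2 * (t ^+ 2 - s ^+ 2).

Lemma thetaR_slope_sq (R : realType) (L : R -> \bar R)
    (hL : inexact_smoothness_fun L) (a s b : R) :
  a ^+ 2 < s ^+ 2 -> s ^+ 2 < b ^+ 2 ->
  (s ^+ 2 - a ^+ 2) * (thetaR L b - thetaR L s) <=
  (b ^+ 2 - s ^+ 2) * (thetaR L s - thetaR L a).
Proof.
move=> as_ sb; have ab : 0 < b ^+ 2 - a ^+ 2 by rewrite subr_gt0 (lt_trans as_).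
have abn0 : b ^+ 2 - a ^+ 2 != 0 by rewrite gt_eqF.
have t01 : 0 <= (b ^+ 2 - s ^+ 2) / (b ^+ 2 - a ^+ 2) <= 1.
  rewrite divr_ge0 ?(ltW ab) ?subr_ge0 ?(ltW sb) //=.
  by rewrite ler_pdivrMr // mul1r lerD2l lerN2 ltW.
have hs : s ^+ 2 = (b ^+ 2 - s ^+ 2) / (b ^+ 2 - a ^+ 2) * a ^+ 2 +
    (1 - (b ^+ 2 - s ^+ 2) / (b ^+ 2 - a ^+ 2)) * b ^+ 2 by field.
have := ler_wpM2l (ltW ab) (thetaR_concave_sq hL t01 hs).
have -> : (b ^+ 2 - a ^+ 2) * ((b ^+ 2 - s ^+ 2) / (b ^+ 2 - a ^+ 2) * thetaR L a +
    (1 - (b ^+ 2 - s ^+ 2) / (b ^+ 2 - a ^+ 2)) * thetaR L b) =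
    (b ^+ 2 - s ^+ 2) * thetaR L a + (s ^+ 2 - a ^+ 2) * thetaR L b by field.
lra.
Qed.

(** As [s ^+ 2] is interior to the half-line, the supremum of the chord slopes to its right is a
    supergradient: by concavity every slope to its left is an upper bound. *)
Lemma exists_touches (R : realType) (L : R -> \bar R)
    (hL : inexact_smoothness_fun L) (s : R) : s != 0 ->
  exists2 a, 0 <= a & touches L s a.
Proof.
move=> s0.
have s2 : 0 < s ^+ 2 by rewrite exprn_even_gt0.
pose slope b := (thetaR L b - thetaR L s) / (b ^+ 2 - s ^+ 2).
pose D := [set slope b | b in [set b | s ^+ 2 < b ^+ 2]].
have D2 : D (slope (2 * s)) by exists (2 * s) => //=; lra.
have slope_ub a : a ^+ 2 < s ^+ 2 ->
    ubound D ((thetaR L s - thetaR L a) / (s ^+ 2 - a ^+ 2)).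
  move=> as_ y [b /= sb <-]; rewrite /slope ler_pdivrMr ?subr_gt0 //.
  rewrite mulrAC ler_pdivlMr ?subr_gt0 // mulrC [leRHS]mulrC.
  exact: thetaR_slope_sq.
have Dub : has_ubound D.
  exists ((thetaR L s - thetaR L 0) / (s ^+ 2 - 0 ^+ 2)).
  by apply: slope_ub; rewrite expr0n.
exists (2 * sup D).
  rewrite mulr_ge0 //; apply: le_trans (ub_le_sup Dub D2).
  by rewrite divr_ge0 // subr_ge0; first apply: (thetaR_homo hL); lra.
move=> t; rewrite [2 * _]mulrC mulfK ?pnatr_eq0 //.
have [st|ts|ts] := ltgtP (s ^+ 2) (t ^+ 2).
- rewrite -lerBlDl -ler_pdivrMr ?subr_gt0 //.
  by apply: ub_le_sup => //; exists t.
- have /(ge_sup (ex_intro _ _ D2)) := slope_ub t ts.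
  rewrite ler_pdivlMr ?subr_gt0 //; lra.
- by rewrite ts subrr mulr0 addr0; apply: (thetaR_homo hL); rewrite ts.
Qed.

Lemma touches_half (R : realType) (L : R -> \bar R)
    (hL : inexact_smoothness_fun L) (s a : R) :
  touches L s a -> a / 2 * s ^+ 2 <= thetaR L s.
Proof. by move=> /(_ 0); rewrite (thetaR0 hL) expr0n /=; lra. Qed.

Lemma touches_decr (R : realType) (L : R -> \bar R) (s r a b : R) :
  touches L s a -> touches L r b -> s ^+ 2 < r ^+ 2 -> b <= a.
Proof.
move=> ha hb sr; have := ha r; have := hb s => h1 h2.
have d0 : 0 < r ^+ 2 - s ^+ 2 by rewrite subr_gt0.
rewrite -(ler_pM2r d0); lra.
Qed.

(* Extending the segment from [t] past [s] by a factor [tau] and bounding the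
   far end by the touching parabola gives the claim up to an error [O(tau)]. *)
Lemma touches_subgrad (R : realType) (L : R -> \bar R)
    (hL : inexact_smoothness_fun L) (s a : R) : 0 <= a -> touches L s a ->
  forall t, thetaR L s + a * s * (t - s) <= thetaR L t.
Proof.
move=> a0 ha t.
apply: (@le_linear_perturb _ _ _ (a / 2 * (s - t) ^+ 2)).
  by rewrite mulr_ge0 ?sqr_ge0 // divr_ge0.
move=> tau tau0 _; have tau1 : 0 < 1 + tau by rewrite addr_gt0.
have l01 : 0 <= tau / (1 + tau) <= 1.
  by rewrite divr_ge0 ?(ltW tau0) ?(ltW tau1) //= ler_pdivrMr // mul1r lerDr.
have := thetaR_convex hL t (s + tau * (s - t)) l01.
have -> : tau / (1 + tau) * t + (1 - tau / (1 + tau)) * (s + tau * (s - t)) = s.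
  by field; rewrite gt_eqF.
move/(ler_wpM2l (ltW tau1)).
have -> : (1 + tau) * (tau / (1 + tau) * thetaR L t +
  (1 - tau / (1 + tau)) * thetaR L (s + tau * (s - t))) =
  tau * thetaR L t + thetaR L (s + tau * (s - t)) by field; rewrite gt_eqF.
have := ha (s + tau * (s - t)) => h1 h2.
rewrite -(ler_pM2l tau0); lra.
Qed.

(** Near [s], [thetaR] lies between a line of slope [g] and a parabola of slope [a * s]; a small
    step along [g - a * s] forces the slopes to agree. *)
Lemma touches_subgrad_uniq (R : realType) (L : R -> \bar R) (s a g : R) :
  0 <= a -> touches L s a -> (forall t, thetaR L s + g * (t - s) <= thetaR L t) ->
  g = a * s.
Proof.
move=> a0 ha hg; apply/eqP; rewrite -subr_eq0 -sqrf_eq0 eq_le sqr_ge0 andbT.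
apply: (@le_linear_perturb _ _ _ (a / 2 * (g - a * s) ^+ 2)).
  by rewrite mulr_ge0 ?sqr_ge0 // divr_ge0.
move=> t t0 _; have := hg (s + t * (g - a * s)); have := ha (s + t * (g - a * s)).
move=> h1 h2; rewrite -(ler_pM2l t0); lra.
Qed.

(** This puts 2 in the set defining [self_smoothness]. The parabola at [s] settles [|r| <= |s|], the
    one at [r] settles longer steps of the same sign. *)
Lemma thetaR_self_smooth2 (R : realType) (L : R -> \bar R)
    (hL : inexact_smoothness_fun L) (s g : R) :
  (forall t, thetaR L s + g * (t - s) <= thetaR L t) ->
  forall r, thetaR L (s + r) <= thetaR L s + g * r + 2 * thetaR L r.
Proof.
move=> hg r; have [s0|s0] := eqVneq s 0.
  have := hg (- r); rewrite s0 (thetaR0 hL) thetaRN !add0r subr0; lra.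
have [a a0 ha] := exists_touches hL s0.
have gE := touches_subgrad_uniq a0 ha hg.
have hs := touches_half hL ha.
have s2 : 0 < s ^+ 2 by rewrite exprn_even_gt0.
have [rs|sr] := leP (r ^+ 2) (s ^+ 2).
  suff : a / 2 * r ^+ 2 <= thetaR L r.
    by have := ha (s + r); have := thetaR_ge0 hL r; rewrite gE; lra.
  rewrite -(ler_pM2l s2); apply: le_trans (thetaR_quad_decr hL rs).
  by have := ler_wpM2l (sqr_ge0 r) hs; lra.
have [r0|r0] := leP 0 (s * r).
  have rn0 : r != 0 by rewrite -sqrf_eq0 gt_eqF // (lt_trans s2).
  have [b b0 hb] := exists_touches hL rn0.
  have ba := touches_decr ha hb sr.
  have := hb (s + r); have := ler_wpM2r r0 ba.
  have := ler_wpM2r (sqr_ge0 s) ba; have := thetaR_ge0 hL r; rewrite gE; lra.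
(* A longer step of opposite sign gives [|s + r| <= |r|]; the subgradient inequality at [- r] then
   controls [- g * r]. *)
have hsr : s ^+ 2 <= - (s * r).
  rewrite -(@ler_pXn2r _ 2) ?nnegrE ?sqr_ge0 ?oppr_ge0 ?(ltW r0) //.
  have := ler_wpM2l (sqr_ge0 s) (ltW sr); lra.
have := hg (- r); rewrite thetaRN.
have : thetaR L (s + r) <= thetaR L r by apply: (thetaR_homo hL); lra.
rewrite gE; lra.
Qed.

(** * Convex functions on R^d *)

Section Dot.
Variables (R : realType) (d : nat).
Implicit Types u v w : 'rV[R]_d.

Lemma dotC u v : dot u v = dot v u.
Proof. by rewrite /dot -[in LHS](trmxK u) -trmx_mul mxE. Qed.

Lemma dotDl u v w : dot (u + v) w = dot u w + dot v w.
Proof. by rewrite /dot mulmxDl mxE. Qed.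

Lemma dotZl (a : R) u v : dot (a *: u) v = a * dot u v.
Proof. by rewrite /dot -scalemxAl mxE. Qed.

Lemma dotNl u v : dot (- u) v = - dot u v.
Proof. by rewrite -scaleN1r dotZl mulN1r. Qed.

Lemma dotDr u v w : dot u (v + w) = dot u v + dot u w.
Proof. by rewrite dotC dotDl !(dotC u). Qed.

Lemma dotZr (a : R) u v : dot u (a *: v) = a * dot u v.
Proof. by rewrite dotC dotZl dotC. Qed.

Lemma dotNr u v : dot u (- v) = - dot u v.
Proof. by rewrite dotC dotNl dotC. Qed.

Lemma dot0l u : dot 0 u = 0.
Proof. by rewrite /dot mul0mx mxE. Qed.

Definition dotE := (dotDl, dotDr, dotZl, dotZr, dotNl, dotNr).

Lemma dot_sum u v : dot u v = \sum_i u 0 i * v 0 i.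
Proof. by rewrite /dot mxE; apply: eq_bigr => i _; rewrite mxE. Qed.

Lemma dot_ge0 u : 0 <= dot u u.
Proof. by rewrite dot_sum sumr_ge0 // => i _; rewrite -expr2 sqr_ge0. Qed.

Lemma dot_eq0 u : dot u u = 0 -> u = 0.
Proof.
rewrite dot_sum => /eqP; rewrite psumr_eq0 => [/allP h|i _]; last first.
  by rewrite -expr2 sqr_ge0.
apply/rowP => i; rewrite mxE; apply/eqP.
by have := h i (mem_index_enum _); rewrite mulf_eq0 orbb.
Qed.

Lemma enorm_ge0 u : 0 <= enorm u.
Proof. exact: sqrtr_ge0. Qed.

Lemma enorm_sq u : enorm u ^+ 2 = dot u u.
Proof. by rewrite sqr_sqrtr // dot_ge0. Qed.

Lemma enormN u : enorm (- u) = enorm u.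
Proof. by rewrite /enorm dotNl dotNr opprK. Qed.

Lemma enormZ (a : R) u : 0 <= a -> enorm (a *: u) = a * enorm u.
Proof.
move=> a0; rewrite /enorm dotZl dotZr mulrA -expr2.
by rewrite sqrtrM ?sqr_ge0 // sqrtr_sqr ger0_norm.
Qed.

Lemma dot_le_enorm u v : dot u v <= enorm u * enorm v.
Proof.
have [u0|u0] := eqVneq (enorm u) 0.
  have /dot_eq0 -> : dot u u = 0 by rewrite -enorm_sq u0 expr0n.
  by rewrite dot0l mulr_ge0 ?enorm_ge0.
have [v0|v0] := eqVneq (enorm v) 0.
  have /dot_eq0 -> : dot v v = 0 by rewrite -enorm_sq v0 expr0n.
  by rewrite dotC dot0l mulr_ge0 ?enorm_ge0.
have := dot_ge0 (enorm v *: u - enorm u *: v).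
rewrite !dotE -!enorm_sq (dotC v u) => h.
have p0 : 0 < enorm u * enorm v by rewrite mulr_gt0 // lt0r enorm_ge0 ?u0 ?v0.
rewrite -(ler_pM2l p0); lra.
Qed.

End Dot.

Definition convex_fun (R : realType) (E : lmodType R) (F : E -> R) : Prop :=
  forall (x y : E) (t : R), 0 <= t <= 1 ->
    F (t *: x + (1 - t) *: y) <= t * F x + (1 - t) * F y.

(** Reflect [y] through [x] to a point [z] at distance at most 1: convexity at [x] between [y] and
    [z], with [F z <= M], bounds [F y] from below. *)
Lemma convex_lsc (R : realType) (d : nat) (F : 'rV[R]_d -> R) :
  convex_fun F ->
  (forall x, exists M, forall z, enorm (z - x) <= 1 -> F z <= M) ->
  lower_semicontinuous (fun x => (F x)%:E).
Proof.
move=> cF bF x a; rewrite lte_fin => aF.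
have [M hM] := bF x.
have MF : F x <= M by apply: hM; rewrite subrr /enorm dot0l sqrtr0.
have D0 : 0 < M - F x + 1 by lra.
(* Chosen so that [(1 + e) * F x - e * M > a]; the [+ 1] makes this strict and the divisor
   positive. *)
pose e := (F x - a) / (M - F x + 1).
have e0 : 0 < e by rewrite divr_gt0 // subr_gt0.
have eD : e * (M - F x + 1) = F x - a by rewrite mulfVK // gt_eqF.
have d0 : 0 < d.+1%:R :> R by rewrite ltr0n.
(* This sup-norm ball lies in the Euclidean ball of radius [e]; [d.+1] also covers dimension 0. *)
exists (ball x (e / d.+1%:R)); first by apply: nbhsx_ballx; rewrite divr_gt0.
move=> y; rewrite -ball_normE /= => xy; rewrite lte_fin.
have coord (i : 'I_d) : (y - x) 0 i * (y - x) 0 i <= (e / d.+1%:R) ^+ 2.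
  rewrite -expr2 -real_normK ?num_real //.
  rewrite ler_pXn2r ?nnegrE ?normr_ge0 ?(ltW (divr_gt0 e0 d0)) //.
  apply: le_trans (ltW xy); rewrite distrC [leRHS]mx_normrE.
  exact: (le_bigmax _ (fun ij : 'I_1 * 'I_d => `|(y - x) ij.1 ij.2|) (0, i)).
have yx : enorm (y - x) <= e.
  rewrite -(@ler_pXn2r _ 2) ?nnegrE ?enorm_ge0 ?(ltW e0) // enorm_sq dot_sum.
  apply: le_trans (ler_sum _ (fun i _ => coord i)) _.
  rewrite sumr_const card_ord -[leLHS]mulr_natl exprMn exprVn mulrA.
  rewrite ler_pdivrMr ?exprn_gt0 // mulrC ler_wpM2l ?sqr_ge0 //.
  by rewrite -natrX ler_nat (leq_trans (leqnSn d)) // leq_pmulr.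
pose z := x - e^-1 *: (y - x).
have hz : F z <= M.
  apply: hM; rewrite /z addrC addKr enormN enormZ ?invr_ge0 ?(ltW e0) //.
  by rewrite ler_pdivrMl // mulr1.
have e1 : 0 < 1 + e by rewrite addr_gt0.
have t01 : 0 <= (1 + e)^-1 <= 1.
  by rewrite invr_ge0 (ltW e1) invf_le1 // lerDl ltW.
have := cF y z _ t01.
have -> : (1 + e)^-1 *: y + (1 - (1 + e)^-1) *: z = x.
  apply/rowP => i; rewrite !mxE; field; rewrite !gt_eqF //.
move/(ler_wpM2l (ltW e1)).
have -> : (1 + e) * ((1 + e)^-1 * F y + (1 - (1 + e)^-1) * F z) = F y + e * F z.
  by field; rewrite gt_eqF.
have := ler_wpM2l (ltW e0) hz; lra.
Qed.

(** The pointwise supremum of all convex minorants: [m0] makes the set of values nonempty and [P i0]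
    bounds it, so [sup] is a genuine supremum. *)
Lemma convex_envelope (R : realType) (E : lmodType R) (I : Type)
    (P : I -> E -> R) (i0 : I) (m0 : E -> R) :
  convex_fun m0 -> (forall i y, m0 y <= P i y) ->
  exists F : E -> R, [/\ convex_fun F, forall i y, F y <= P i y &
    forall m, convex_fun m -> (forall i y, m y <= P i y) ->
      forall y, m y <= F y].
Proof.
move=> cm0 hm0.
pose M := [set m : E -> R | convex_fun m /\ forall i y, m y <= P i y].
pose V y := [set m y | m in M].
have V0 y : V y !=set0 by exists (m0 y), m0.
have Vub y i : ubound (V y) (P i y) by move=> _ [m [_ hm] <-].
have leV m y : M m -> m y <= sup (V y).
  by move=> Mm; apply: ub_le_sup; [exists (P i0 y)|exists m].
exists (fun y => sup (V y)); split.
- move=> x y t /[dup] t01 /andP[t0 t1]; apply: ge_sup => // _ [m Mm <-].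
  apply: le_trans (Mm.1 x y t t01) _; apply: lerD.
    by rewrite ler_wpM2l // leV.
  by rewrite ler_wpM2l ?subr_ge0 // leV.
- by move=> i y; apply: ge_sup.
- by move=> m cm hm y; apply: leV.
Qed.

(** * Self-smoothness and the convex envelope *)

(** The inequality defining [self_smoothness] with [delta] eliminated: the infimum over [delta] of
    the rescaled parabolas at [r] is [c * thetaR L r]. *)
Definition self_smooth (R : realType) (L : R -> \bar R) (c : R) : Prop :=
  forall s g, (forall t, thetaR L s + g * (t - s) <= thetaR L t) ->
    forall r, thetaR L (s + r) <= thetaR L s + g * r + c * thetaR L r.

Lemma self_smooth_ge1 (R : realType) (L : R -> \bar R)
    (hL : inexact_smoothness_fun L) (c : R) : self_smooth L c -> 1 <= c.
Proof.
move=> hc; have t1 : 0 < thetaR L 1 by rewrite (thetaR_gt0 hL) ?oner_neq0.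
have sub0 t : thetaR L 0 + 0 * (t - 0) <= thetaR L t.
  by rewrite mul0r addr0 (thetaR0 hL) thetaR_ge0.
have := hc 0 0 sub0 1.
by rewrite mul0r (thetaR0 hL) !add0r -[leLHS]mul1r ler_pM2r.
Qed.

Lemma thetaR_scale (R : realType) (L : R -> \bar R) (hL : inexact_smoothness_fun L)
    (k s : R) : 1 <= k -> thetaR L (k * s) <= k ^+ 2 * thetaR L s.
Proof.
move=> k1; have [->|s0] := eqVneq s 0; first by rewrite mulr0 (thetaR0 hL) mulr0.
have s2 : 0 < s ^+ 2 by rewrite exprn_even_gt0.
have k2 : 1 <= k ^+ 2 by rewrite exprn_ege1.
rewrite -(ler_pM2l s2) mulrCA mulrA -exprMn; apply: (thetaR_quad_decr hL).
by rewrite exprMn ler_peMl // ltW.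
Qed.

(* With [s = |z|], the parabola touching at [s] settles [|r| <= 2 s] (self
   smoothness from [s] to [- s] compares its curvature with [theta]); for
   [|r| > 2 s] the worst [r] is antiparallel to [z], a one-dimensional case. *)
Lemma thetaR_enorm_smooth (R : realType) (L : R -> \bar R)
    (hL : inexact_smoothness_fun L) (c : R) (d : nat) (z : 'rV[R]_d) :
  self_smooth L c ->
  exists g, (forall y, thetaR L (enorm z) + dot g (y - z) <= thetaR L (enorm y)) /\
    forall r, thetaR L (enorm (z + r)) <=
      thetaR L (enorm z) + dot g r + c * thetaR L (enorm r).
Proof.
move=> hc; have c1 := self_smooth_ge1 hL hc.
have [->|z0] := eqVneq z 0.
  exists 0; have -> : enorm (0 : 'rV[R]_d) = 0 by rewrite /enorm dot0l sqrtr0.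
  split=> [y|r]; rewrite dot0l (thetaR0 hL) ?addr0 ?add0r ?thetaR_ge0 //.
  by rewrite ler_peMl // thetaR_ge0.
move sE : (enorm z) => s.
have s0 : s != 0.
  by apply: contra_neq z0 => sz; apply: dot_eq0; rewrite -enorm_sq sE sz expr0n.
have sp : 0 < s by rewrite lt0r s0 -sE enorm_ge0.
have s2 : 0 < s ^+ 2 by rewrite exprn_gt0.
have [a a0 ha] := exists_touches hL s0.
have sub := touches_subgrad hL a0 ha.
exists (a *: z); split=> [y|r].
  apply: le_trans (sub (enorm y)); rewrite lerD2l dotZl dotDr dotNr -enorm_sq sE.
  by have := ler_wpM2l a0 (dot_le_enorm z y); rewrite sE; lra.
have smooth := hc _ _ sub.
have zr : enorm (z + r) ^+ 2 = s ^+ 2 + 2 * dot z r + enorm r ^+ 2.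
  by rewrite -sE !enorm_sq !dotE (dotC r z); ring.
rewrite dotZl.
have [rs|sr] := leP (enorm r ^+ 2) ((2 * s) ^+ 2).
  suff hr : a / 2 * enorm r ^+ 2 <= c * thetaR L (enorm r).
    have := ha (enorm (z + r)); rewrite zr; move: hr.
    move: (thetaR L (enorm (z + r))) (thetaR L s) (c * thetaR L (enorm r)).
    by move: (dot z r) (enorm r) => *; lra.
  have := smooth (- (2 * s)); rewrite thetaRN.
  have -> : s + - (2 * s) = - s by ring.
  rewrite thetaRN => h.
  rewrite -(ler_pM2l s2).
  have := ler_wpM2l (le_trans ler01 c1) (thetaR_quad_decr hL rs).
  have := ler_wpM2r (sqr_ge0 (enorm r)) h.
  move: (enorm r) (thetaR L s) (thetaR L (enorm r)) (thetaR L (2 * s)) => *; lra.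
have {}sr : 2 * s < enorm r.
  by move: sr; rewrite ltr_pXn2r ?nnegrE ?enorm_ge0 // mulr_ge0 // ltW.
(* An antiparallel [r] leads to norm [enorm r - s]; a general one exceeds its square by
   [2 * dot z r + 2 * s * enorm r], which the parabola touching there absorbs. *)
have t0 : enorm r - s != 0 by rewrite gt_eqF //; lra.
have [b b0 hb] := exists_touches hL t0.
have ba : b <= a.
  by apply: touches_decr ha hb _; rewrite ltr_pXn2r // ?nnegrE; lra.
have cs : 0 <= 2 * dot z r + 2 * s * enorm r.
  by have := dot_le_enorm (- z) r; rewrite dotNl enormN sE; lra.
have := hb (enorm (z + r)); rewrite zr.
have := smooth (- enorm r); rewrite thetaRN.
have -> : s + - enorm r = - (enorm r - s) by ring.
rewrite thetaRN; have := ler_wpM2r cs ba.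
move: (thetaR L (enorm (z + r))) (thetaR L s) (thetaR L (enorm r)).
move: (thetaR L (enorm r - s)).
by move: (dot z r) (enorm r) => *; lra.
Qed.

(* Smoothness with the subgradient eliminated, so that it passes to convex
   envelopes. *)
Lemma thetaR_enorm_three_points (R : realType) (L : R -> \bar R)
    (hL : inexact_smoothness_fun L) (c : R) (d : nat) (y r : 'rV[R]_d) (t : R) :
  self_smooth L c -> 0 < t ->
  t * thetaR L (enorm (y + r)) + thetaR L (enorm (y - t *: r)) <=
  (1 + t) * thetaR L (enorm y) + t * (c * ((1 + t) ^+ 2 * thetaR L (enorm r))).
Proof.
move=> hc t0; have c1 := self_smooth_ge1 hL hc.
have t1 : 0 <= 1 + t by rewrite addr_ge0 // ltW.
(* Based at [y - t *: r], the subgradient inequality reaches [y] and smoothness reaches [y + r];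
   weights [1 + t] and [t] cancel [dot g r]. *)
have [g [hsub hg]] := thetaR_enorm_smooth hL (y - t *: r) hc.
have := hsub y; have -> : y - (y - t *: r) = t *: r by rewrite opprB addrC subrK.
have := hg ((1 + t) *: r).
have -> : y - t *: r + (1 + t) *: r = y + r.
  by rewrite scalerDl scale1r addrA addrAC subrK.
rewrite !dotZr enormZ // => h1 h2.
have hs : thetaR L ((1 + t) * enorm r) <= (1 + t) ^+ 2 * thetaR L (enorm r).
  by apply: (thetaR_scale hL); rewrite lerDl ltW.
have combine (A B C D E G : R) :
    B + t * G <= C -> A <= B + (1 + t) * G + c * E -> c * E <= c * D ->
    t * A + B <= (1 + t) * C + t * (c * D).
  move=> h4 h5 h6; have := ler_wpM2l (ltW t0) h5.
  by have := ler_wpM2l (ltW t0) h6; have := ler_wpM2l t1 h4; lra.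
exact: combine h2 h1 (ler_wpM2l (le_trans ler01 c1) hs).
Qed.

Lemma envelope_three_points (R : realType) (E : lmodType R) (I : Type)
    (P : I -> E -> R) (F : E -> R) (r : E) (t K : R) :
  0 < t -> convex_fun F -> (forall i y, F y <= P i y) ->
  (forall m, convex_fun m -> (forall i y, m y <= P i y) ->
     forall y, m y <= F y) ->
  (forall i y, t * P i (y + r) + P i (y - t *: r) <= (1 + t) * P i y + K) ->
  forall y, t * F (y + r) + F (y - t *: r) <= (1 + t) * F y + K.
Proof.
move=> t0 cF FP Fmax hP y; have t1 : 0 < 1 + t by rewrite addr_gt0.
rewrite -lerBlDr -ler_pdivrMl //.
(* This function is convex, and [F <= P i] with [hP] puts it below every [P i]. *)
apply: (Fmax (fun y => (1 + t)^-1 * (t * F (y + r) + F (y - t *: r) - K)))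
  => [u v l l01|i z]; last first.
  rewrite ler_pdivrMl // lerBlDr; apply: le_trans (hP i z).
  by rewrite lerD // ler_wpM2l // ltW.
have shift w : l *: u + (1 - l) *: v + w = l *: (u + w) + (1 - l) *: (v + w).
  rewrite !scalerDr addrACA -scalerDl.
  by rewrite [l + _]addrC subrK scale1r.
have h1 := cF (u + r) (v + r) _ l01.
have h2 := cF (u - t *: r) (v - t *: r) _ l01.
rewrite !shift ler_pdivrMl //.
have := ler_wpM2l (ltW t0) h1.
set A := F (u + r); set B := F (v + r).
set C := F (u - t *: r); set D := F (v - t *: r); rewrite -/C -/D in h2.
have -> : (1 + t) * (l * ((1 + t)^-1 * (t * A + C - K)) +
  (1 - l) * ((1 + t)^-1 * (t * B + D - K))) =
  l * (t * A + C - K) + (1 - l) * (t * B + D - K).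
  by field; rewrite gt_eqF.
lra.
Qed.

(** * Interpolation *)

(** A single bound by [c * thetaR] gives the whole family in [delta], since [thetaR] is below its
    parabola of offset [delta / c]. *)
Lemma inexactly_smooth_rescale (R : realType) (L : R -> \bar R)
    (hL : inexact_smoothness_fun L) (d : nat) (F : 'rV[R]_d -> R) (c : R) :
  0 < c -> convex_fun F ->
  (forall x, exists M, forall z, enorm (z - x) <= 1 -> F z <= M) ->
  (forall x g, (forall y, F x + dot g (y - x) <= F y) ->
     forall r, F (x + r) <= F x + dot g r + c * thetaR L (enorm r)) ->
  inexactly_smooth (rescale c L) (fun x => (F x)%:E).
Proof.
move=> c0 cF bF hF; split.
- exact: convex_lsc.
- move=> x y t _ _ t01; rewrite -!EFinM -EFinD lee_fin; exact: cF.
- by split=> [x|]; [rewrite ltNyr | exists 0; rewrite ltry].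
- move=> x y g e hg e0 efin.
  have ec0 : 0 <= e / c by rewrite divr_ge0 // ltW.
  have lfin : (L (e / c)%R < +oo)%E.
    move: efin; rewrite /rescale; have := isf_gt0 hL ec0.
    case: (L (e / c)) => [l| |] // _; first by rewrite !ltry.
    by rewrite gt0_muley ?lte_fin.
  have [Lr l0] := isf_fineE hL ec0 lfin.
  rewrite /rescale Lr inver pnatr_eq0 /= -!EFinM -!EFinD lee_fin.
  have hsub y' : F x + dot g (y' - x) <= F y'.
    by have := hg y'; rewrite -EFinD lee_fin.
  have := hF x g hsub (y - x).
  have -> : x + (y - x) = y by rewrite addrC subrK.
  move=> /le_trans; apply; rewrite -[leRHS]addrA lerD2l.
  have := ler_wpM2l (ltW c0) (thetaR_le hL (enorm (y - x)) ec0 lfin).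
  have -> : c * (fine (L (e / c)) / 2 * enorm (y - x) ^+ 2 + e / c) =
    c * fine (L (e / c)) / 2 * enorm (y - x) ^+ 2 + e by field; rewrite gt_eqF.
  by [].
Qed.

Lemma dot_scalar (R : realType) (u v : 'rV[R]_1) : dot u v = u 0 0 * v 0 0.
Proof. by rewrite dot_sum big_ord1. Qed.

Lemma rescaled_self_smooth (R : realType) (L : R -> \bar R)
    (hL : inexact_smoothness_fun L) (c : R) : 0 < c ->
  inexactly_smooth (rescale c L) (fun s : 'rV[R]_1 => theta L (s 0 0)) ->
  self_smooth L c.
Proof.
move=> c0 [_ _ _ hc] s g hg r.
rewrite -lerBlDl -ler_pdivrMl //; apply: (thetaR_ge hL) => e e0.
have [Le l0] := isf_posE hL e0.
have hsub : subdifferential (fun s : 'rV[R]_1 => theta L (s 0 0)) s%:M g%:M.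
  move=> y; rewrite !(thetaE hL) -EFinD lee_fin dot_scalar !mxE /= !mulr1n.
  exact: hg.
(* The offset [c * e] undoes the rescaling: [rescale c L (c * e)] is [c * L e]. *)
have := hc s%:M (s + r)%:M g%:M (c * e) hsub (mulr_ge0 (ltW c0) (ltW e0)).
have -> : rescale c L (c * e) = (c * fine (L e))%:E.
  by rewrite /rescale mulrAC divff ?gt_eqF // mul1r Le.
rewrite ltry => /(_ isT).
rewrite !(thetaE hL) enorm_sq !dot_scalar !mxE /= !mulr1n.
have -> : s + r - s = r by ring.
rewrite inver pnatr_eq0 /= -!EFinM -!EFinD lee_fin ler_pdivrMl // => h.
rewrite lerBlDl; apply: le_trans h _; rewrite le_eqVlt; apply/orP; left.
apply/eqP; ring.
Qed.

Lemma rescale2_smooth (R : realType) (L : R -> \bar R)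
    (hL : inexact_smoothness_fun L) :
  inexactly_smooth (rescale 2 L) (fun s : 'rV[R]_1 => theta L (s 0 0)).
Proof.
have -> : (fun s : 'rV[R]_1 => theta L (s 0 0)) = (fun s => (thetaR L (s 0 0))%:E).
  by apply/funext => s; rewrite (thetaE hL).
apply: (inexactly_smooth_rescale hL) => //.
- by move=> x y t t01; rewrite !mxE; apply: thetaR_convex.
- move=> x; exists (thetaR L (`|x 0 0| + 1)) => z.
  have -> : enorm (z - x) = `|z 0 0 - x 0 0|.
    by rewrite /enorm dot_scalar -expr2 sqrtr_sqr !mxE.
  move=> zx; rewrite -thetaR_norm; apply: (thetaR_homo hL).
  rewrite ler_pXn2r ?nnegrE ?addr_ge0 ?normr_ge0 //.
  by rewrite -[z 0 0](subrK (x 0 0)) (le_trans (ler_normD _ _)) // addrC lerD2l.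
- move=> x g hg r.
  have hg' t : thetaR L (x 0 0) + g 0 0 * (t - x 0 0) <= thetaR L t.
    by have := hg t%:M; rewrite dot_scalar !mxE /= mulr1n.
  have := thetaR_self_smooth2 hL hg' (r 0 0).
  have -> : enorm r = `|r 0 0| by rewrite /enorm dot_scalar -expr2 sqrtr_sqr.
  by rewrite thetaR_norm dot_scalar mxE.
Qed.

(** For fixed [s], [g] and [r != 0] the inequality is a lower bound on [c], so it passes to the
    infimum. *)
Lemma self_smoothness_attained (R : realType) (L : R -> \bar R)
    (hL : inexact_smoothness_fun L) : self_smooth L (self_smoothness L).
Proof.
rewrite /self_smoothness; set S := [set c : R | _].
have S2 : S 2 by split=> //; exact: rescale2_smooth.
move=> s g hg r; rewrite -lerBlDl.
have hS c : S c -> thetaR L (s + r) - (thetaR L s + g * r) <= c * thetaR L r.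
  by move=> [c0 hc]; rewrite lerBlDl; apply: (rescaled_self_smooth hL c0 hc).
have [r0|r0] := eqVneq r 0.
  by have := hS _ S2; rewrite r0 (thetaR0 hL) !mulr0.
have t0 := thetaR_gt0 hL r0.
rewrite -ler_pdivrMr //; apply: lb_le_inf; first by exists 2.
by move=> c /hS; rewrite ler_pdivrMr.
Qed.

Lemma interpolable_ineq (R : realType) (L : R -> \bar R)
    (hL : inexact_smoothness_fun L) (d : nat) (I : Type)
    (x : I -> 'rV[R]_d) (f : I -> R) (g : I -> 'rV[R]_d) :
  interpolable L x f g -> interpolation_ineq L x f g.
Proof.
move=> [F [[_ _ _ smooth] hF]] i j e e0.
have [Fi gi] := hF i; have [Fj gj] := hF j.
have low y := gj y; rewrite Fj in low.
(* If [L e] is infinite, the squared term vanishes and the subgradient inequality at [x j]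
   suffices. *)
have [lfin|] := ltP (L e) +oo%E; last first.
  rewrite leye_eq => /eqP ->; rewrite gt0_muley ?lte_fin // invey mul0e sube0.
  have := low (x i); rewrite Fi -!EFinB -!EFinD !lee_fin; lra.
have [Le l0] := isf_fineE hL e0 lfin.
(* This point minimises the gap between the upper parabola at [x i] and the affine minorant at
   [x j]; that gap is the claimed quantity. *)
have := smooth (x i) (x i - (fine (L e))^-1 *: (g i - g j)) (g i) e gi e0 lfin.
have := low (x i - (fine (L e))^-1 *: (g i - g j)).
move=> h1 h2; have := le_trans h1 h2.
rewrite Fi Le -EFinM !inver pnatr_eq0 mulf_eq0 pnatr_eq0 (gt_eqF l0) /=.
rewrite -!EFinM -!EFinB -!EFinD !lee_fin.
move: (fine (L e)) l0 => l l0.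
rewrite !enorm_sq !dotE (dotC (g j) (g i)) => h.
have ln0 : l != 0 by rewrite gt_eqF.
set gii := dot (g i) (g i) in h *; set gij := dot (g i) (g j) in h *.
set gjj := dot (g j) (g j) in h *.
rewrite -subr_ge0 in h; apply: le_trans h _.
rewrite le_eqVlt; apply/orP; left; apply/eqP; field.
by [].
Qed.

Lemma ineq_interpolable (R : realType) (L : R -> \bar R)
    (hL : inexact_smoothness_fun L) (c : R) (d : nat) (I : Type)
    (x : I -> 'rV[R]_d) (f : I -> R) (g : I -> 'rV[R]_d) (i0 : I) :
  self_smooth L c -> interpolation_ineq L x f g ->
  interpolable (rescale c L) x f g.
Proof.
move=> hc hI; have c0 : 0 < c := lt_le_trans ltr01 (self_smooth_ge1 hL hc).
pose aff i y := f i + dot (g i) (y - x i).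
pose P j y := aff j y + thetaR L (enorm (y - x j)).
have aff_convex i : convex_fun (aff i).
  by move=> u v t _; rewrite /aff !dotE; lra.
have affP i j y : aff i y <= P j y.
  rewrite /P -lerBlDl; apply: (thetaR_ge hL) => e e0.
  have [Le l0] := isf_posE hL e0; have := hI j i e (ltW e0).
  rewrite Le -EFinM inver mulf_eq0 pnatr_eq0 (gt_eqF l0) /=.
  rewrite -!EFinD lee_fin !enorm_sq.
  move: (fine (L e)) l0 => l l0; have ln0 : l != 0 by rewrite gt_eqF.
  (* Completing the square trades the gradient term of [hI] for the parabola of curvature [l] in
     [P j]. *)
  have := dot_ge0 ((g i - g j) - l *: (y - x j)).
  rewrite /aff !dotE (dotC (g j) (g i)) (dotC (x j) y).
  rewrite (dotC y (g i)) (dotC y (g j)) (dotC (x j) (g i)) (dotC (x j) (g j)).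
  have k0 : 0 <= (2 * l)^-1 by rewrite invr_ge0 mulr_ge0 // ltW.
  move=> /(mulr_ge0 k0) h1 h2; rewrite -subr_ge0.
  apply: le_trans (addr_ge0 h1 h2) _.
  by rewrite le_eqVlt; apply/orP; left; apply/eqP; field.
have [F [cF FP Fmax]] := convex_envelope i0 (aff_convex i0) (affP i0).
have affF i y : aff i y <= F y by apply: Fmax.
have Fx i : F (x i) = f i.
  apply/le_anti; have := affF i (x i); have := FP i (x i).
  rewrite /P /aff subrr dotC dot0l /enorm dot0l sqrtr0 (thetaR0 hL) !addr0.
  by move=> -> ->.
exists (fun y => (F y)%:E); split; last first.
  move=> i; split=> [|y]; first by rewrite Fx.
  by rewrite Fx -EFinD lee_fin; apply: affF.
apply: (inexactly_smooth_rescale hL) => // [z|z h hsub r].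
  have [L1 l1] := isf_posE hL (@ltr01 R).
  (* The bound comes from [P i0] alone: Cauchy-Schwarz for the affine part, the parabola of offset 1
     for [thetaR]. *)
  exists (f i0 + enorm (g i0) * (1 + enorm (z - x i0))
    + (fine (L 1) * (1 + enorm (z - x i0) ^+ 2) + 1)).
  move=> y yz; apply: le_trans (FP i0 y) _; rewrite /P /aff.
  have split_y : y - x i0 = (y - z) + (z - x i0) by rewrite addrA subrK.
  apply: lerD.
    rewrite lerD2l split_y dotDr mulrDr mulr1 lerD ?dot_le_enorm //.
    by apply: le_trans (dot_le_enorm _ _) _; rewrite ler_piMr // enorm_ge0.
  apply: le_trans (thetaR_le hL _ ler01 (isf_fin hL ltr01)) _; rewrite lerD2r.
  rewrite -mulrA ler_wpM2l ?(ltW l1) //.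
  have yz2 : enorm (y - z) ^+ 2 <= 1 by rewrite expr_le1 ?enorm_ge0.
  have := dot_ge0 ((y - z) - (z - x i0)); move: yz2.
  rewrite split_y !enorm_sq; move: (y - z) (z - x i0) => u v.
  rewrite !dotE (dotC v u); lra.
have K0 : 0 <= c * thetaR L (enorm r) by rewrite mulr_ge0 ?thetaR_ge0 // ltW.
(* The 3 comes from [(1 + t) ^+ 2 <= 1 + t * 3] for [t <= 1]. *)
apply: (@le_linear_perturb _ _ _ (3 * (c * thetaR L (enorm r)))).
  by rewrite mulr_ge0.
move=> t t0 t1.
have h3 : t * F (z + r) + F (z - t *: r) <=
    (1 + t) * F z + t * (c * ((1 + t) ^+ 2 * thetaR L (enorm r))).
  apply: (envelope_three_points t0 cF FP Fmax) => i y.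
  have := thetaR_enorm_three_points hL (y - x i) r hc t0.
  rewrite /P /aff; have -> : y + r - x i = y - x i + r by rewrite addrAC.
  have -> : y - t *: r - x i = y - x i - t *: r by rewrite addrAC.
  (* The affine part of [P i] contributes equally to both sides. *)
  have affine_shift (A B C K q a b : R) : t * A + B <= (1 + t) * C + K ->
    t * (q + (a + b) + A) + (q + (a - t * b) + B) <= (1 + t) * (q + a + C) + K.
    lra.
  rewrite (dotDr _ (y - x i) r) (dotDr _ (y - x i) (- _)) dotNr dotZr.
  exact: affine_shift.
(* The subgradient bounds [F (z - t *: r)] from below; dividing [h3] by [t] leaves smoothness along
   [h]. *)
have := hsub (z - t *: r); rewrite [_ - z]addrC addrA addNr add0r dotNr dotZr.
have ht : (1 + t) ^+ 2 <= 1 + t * 3.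
  by have := ler_wpM2l (ltW t0) t1; lra.
have := ler_wpM2l K0 ht => h5 h4.
rewrite -(ler_pM2l t0).
have := ler_wpM2l (ltW t0) h5; lra.
Qed.

Theorem theorem3p3 (R : realType) (L : R -> \bar R) (d : nat) (I : Type)
    (x : I -> 'rV[R]_d) (f : I -> R) (g : I -> 'rV[R]_d)
    (hL : inexact_smoothness_fun L) :
  (interpolable L x f g -> interpolation_ineq L x f g) /\
  (interpolation_ineq L x f g ->
   interpolable (rescale (self_smoothness L) L) x f g).
Proof.
have hc := self_smoothness_attained hL.
split; first exact: interpolable_ineq.
have [i0|I0] := pselect (exists i : I, True).
  by case: i0 => i0 _; apply: ineq_interpolable.
(* Without observations there is no [P i] to envelop; the zero function serves. *)
move=> _; exists (fun=> 0%:E); split; last by move=> i; case: I0; exists i.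
have c0 := lt_le_trans ltr01 (self_smooth_ge1 hL hc).
apply: (inexactly_smooth_rescale (F := fun=> 0) hL) => //.
- by move=> u v t _; rewrite !mulr0 addr0.
- by move=> u; exists 0.
- move=> u h hsub r; have := hsub (u - r).
  have -> : u - r - u = - r by rewrite addrAC subrr add0r.
  rewrite dotNr !add0r => hr.
  by rewrite addr_ge0 ?mulr_ge0 ?(ltW c0) ?thetaR_ge0 // -oppr_le0.
Qed.
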